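(* Let $(X,S)$ be a nondegenerate braided set, with $A_X$, $\psi_A:X\to A_X$, $p:A_X\to A_X^0$, $M_X$ and $\psi_M:X\to M_X$ as defined in the context. Then: (i) There exists a unique 1-cocycle $\theta:A_X\to M_X$ such that $\theta\psi_A=\psi_M$, where $A_X$ acts on $M_X$ via $p$. (ii) $\theta$ is injective on $\psi_A(X)$.
   Context: Let $X$ be a nonempty set and $S:X\times X\to X\times X$ a bijection, written $S(x,y)=(g_x(y),f_y(x))$. $(X,S)$ is a braided set if $S_1S_2S_1=S_2S_1S_2$ on $X^3$, where $S_1=S\times \mathrm{id}$, $S_2=\mathrm{id}\times S$; it is nondegenerate if all maps $g_x$ and $f_y$ are bijections of $X$. Write $x\circ y=g_x(y)$, $y*x=f_y^{-1}(x)$, $y^{-1}*x=f_y(x)$, and $\phi(y,x)=x^{-1}*((y*x)\circ y)$. The derived structure group $A_X$ is the group generated by the elements of $X$ with relations $x_1\bullet y=y_2\bullet x_1$ for $x,y\in X$, where $S(x,y)=(y_1,x_1)$, $S(y_1,x_1)=(x_2,y_2)$; equivalently, the relations are $\phi(y,x)\bullet x=x\bullet y$ for $x,y\in X$. $\psi_A:X\to A_X$ is the natural map. The group $A_X$ acts on $X$ with $\psi_A(x)$ acting by $y\mapsto\phi(y,x)$; $A_X^0\subset \mathrm{Permut}(X)$ is the image of $A_X$ under this action and $p:A_X\to A_X^0$ the resulting surjection; write $p(x)$ for $p(\psi_A(x))$, $x\in X$. $M_X$ is the left $A_X^0$-module (i.e. $\mathbb{Z}[A_X^0]$-module) generated by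 symbols $v_x$, $x\in X$, subject to the relations $p(y)^{-1}v_x+v_y=p(x)^{-1}v_{\phi(y,x)}+v_x$ for $x,y\in X$. The map $\psi_M:X\to M_X$ is $x\mapsto v_x$. A 1-cocycle $\theta:A_X\to M_X$ is a map satisfying $\theta(a\bullet b)=b^{-1}\theta(a)+\theta(b)$ for all $a,b\in A_X$. *)

(* Defs.v *)
From HB Require Import structures.
From mathcomp Require Import all_boot all_order all_algebra.
From mathcomp Require Import generic_quotient boolp classical_sets functions.

Set Implicit Arguments.
Unset Strict Implicit.
Unset Printing Implicit Defensive.

Import GRing.Theory.

Local Open Scope group_scope.
Local Open Scope quotient_scope.

Lemma morphM_morphF (G H : groupType) (f : G -> H) :
  {morph f : a b / a * b} -> {morph f : a b / a / b}.
Proof.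
by move=> fM a b; apply: (mulIg (f b)); rewrite -fM !mulgVK.
Qed.

Inductive gterm (X : Type) : Type :=
| GGen of X
| GOne
| GInv of gterm X
| GMul of gterm X & gterm X.
Arguments GOne {X}.

(* The least group congruence containing [rel]: the group <X | rel> is the
   quotient of [gterm X] by it. *)
Inductive gcong (X : Type) (rel : gterm X -> gterm X -> Prop) :
    gterm X -> gterm X -> Prop :=
| gcong_rel s t : rel s t -> gcong rel s t
| gcong_refl s : gcong rel s s
| gcong_sym s t : gcong rel s t -> gcong rel t s
| gcong_trans s t u : gcong rel s t -> gcong rel t u -> gcong rel s u
| gcong_inv s s' : gcong rel s s' -> gcong rel (GInv s) (GInv s')
| gcong_mul s s' t t' :
    gcong rel s s' -> gcong rel t t' -> gcong rel (GMul s t) (GMul s' t')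
| gcong_mulA s t u : gcong rel (GMul s (GMul t u)) (GMul (GMul s t) u)
| gcong_mul1 s : gcong rel (GMul GOne s) s
| gcong_1mul s : gcong rel (GMul s GOne) s
| gcong_mulV s : gcong rel (GMul (GInv s) s) GOne
| gcong_Vmul s : gcong rel (GMul s (GInv s)) GOne.

HB.instance Definition _ (X : Type) := gen_eqMixin (gterm X).
HB.instance Definition _ (X : Type) := gen_choiceMixin (gterm X).

Section PresentedGroup.
Variables (X : Type) (rel : gterm X -> gterm X -> Prop).

Definition gcongb (s t : gterm X) : bool := `[< gcong rel s t >].

Fact gcongb_refl : reflexive gcongb.
Proof. by move=> s; apply/asboolP; exact: gcong_refl. Qed.

Fact gcongb_sym : symmetric gcongb.
Proof. by move=> s t; apply/asboolP/asboolP; exact: gcong_sym. Qed.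

Fact gcongb_trans : transitive gcongb.
Proof.
move=> t s u /asboolP st /asboolP tu.
by apply/asboolP; apply: gcong_trans st tu.
Qed.

Canonical gcong_equiv := EquivRel gcongb gcongb_refl gcongb_sym gcongb_trans.

Definition presG : Type := {eq_quot gcong_equiv}.
HB.instance Definition _ := Choice.on presG.

Definition presG_class (s : gterm X) : presG := \pi_({eq_quot gcong_equiv}) s.
Definition presG_repr (a : presG) : gterm X :=
  repr (a : {eq_quot gcong_equiv}).

Lemma presG_reprK : cancel presG_repr presG_class.
Proof. by move=> a; rewrite /presG_class /presG_repr reprK. Qed.

Lemma presG_eqP s t : presG_class s = presG_class t <-> gcong rel s t.
Proof.
rewrite /presG_class; split=> [/eqP|h].
  by rewrite eqmodE => /asboolP.
by apply/eqP; rewrite eqmodE; apply/asboolP.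
Qed.

Lemma presG_ind (P : presG -> Prop) :
  (forall s, P (presG_class s)) -> forall a, P a.
Proof. by move=> h a; rewrite -(presG_reprK a). Qed.

Lemma presG_classK s : gcong rel (presG_repr (presG_class s)) s.
Proof. by apply/presG_eqP; rewrite presG_reprK. Qed.

Definition presG_one : presG := presG_class GOne.
Definition presG_inv (a : presG) : presG := presG_class (GInv (presG_repr a)).
Definition presG_mul (a b : presG) : presG :=
  presG_class (GMul (presG_repr a) (presG_repr b)).

Lemma presG_invE s : presG_inv (presG_class s) = presG_class (GInv s).
Proof. by apply/presG_eqP; apply: gcong_inv; exact: presG_classK. Qed.

Lemma presG_mulE s t :
  presG_mul (presG_class s) (presG_class t) = presG_class (GMul s t).
Proof. by apply/presG_eqP; apply: gcong_mul; exact: presG_classK. Qed.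

Fact presG_mulA : associative presG_mul.
Proof.
elim/presG_ind=> s; elim/presG_ind=> t; elim/presG_ind=> u.
by rewrite !presG_mulE; apply/presG_eqP; exact: gcong_mulA.
Qed.

Fact presG_mul1 : left_id presG_one presG_mul.
Proof.
by elim/presG_ind=> s; rewrite presG_mulE; apply/presG_eqP; exact: gcong_mul1.
Qed.

Fact presG_1mul : right_id presG_one presG_mul.
Proof.
by elim/presG_ind=> s; rewrite presG_mulE; apply/presG_eqP; exact: gcong_1mul.
Qed.

Fact presG_mulV : left_inverse presG_one presG_inv presG_mul.
Proof.
elim/presG_ind=> s; rewrite presG_invE presG_mulE.
by apply/presG_eqP; exact: gcong_mulV.
Qed.

Fact presG_Vmul : right_inverse presG_one presG_inv presG_mul.
Proof.
elim/presG_ind=> s; rewrite presG_invE presG_mulE.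
by apply/presG_eqP; exact: gcong_Vmul.
Qed.

HB.instance Definition _ := isGroup.Build presG
  presG_mulA presG_mul1 presG_1mul presG_mulV presG_Vmul.

Definition presG_gen (x : X) : presG := presG_class (GGen x).

End PresentedGroup.

Section PresentedGroupLift.
Variables (X : Type) (H : groupType) (f : X -> H).

Fixpoint geval (s : gterm X) : H :=
  match s with
  | GGen x => f x
  | GOne => 1
  | GInv s => (geval s)^-1
  | GMul s t => geval s * geval t
  end.

Variable rel : gterm X -> gterm X -> Prop.
Hypothesis f_rel : forall s t, rel s t -> geval s = geval t.

Lemma geval_cong s t : gcong rel s t -> geval s = geval t.
Proof.
elim=> {s t} //=.
- by move=> s t u _ -> _ ->.
- by move=> s s' _ ->.
- by move=> s s' t t' _ -> _ ->.
- by move=> s t u; rewrite mulgA.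
- by move=> s; rewrite mul1g.
- by move=> s; rewrite mulg1.
- by move=> s; rewrite mulVg.
- by move=> s; rewrite mulgV.
Qed.

Definition presG_lift (a : presG rel) : H := geval (presG_repr a).

Lemma presG_liftE s : presG_lift (presG_class rel s) = geval s.
Proof. by apply: geval_cong; exact: presG_classK. Qed.

Lemma presG_lift_gen x : presG_lift (presG_gen rel x) = f x.
Proof. exact: presG_liftE. Qed.

Lemma presG_liftM : {morph presG_lift : a b / a * b}.
Proof.
elim/presG_ind=> s; elim/presG_ind=> t.
by rewrite [_ * _]presG_mulE !presG_liftE.
Qed.

End PresentedGroupLift.

Definition Permut (X : Type) : Type := {s : X -> X | bijective s}.

HB.instance Definition _ (X : Type) := gen_eqMixin (Permut X).
HB.instance Definition _ (X : Type) := gen_choiceMixin (Permut X).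

Section Permut.
Variable X : Type.
Implicit Types s t : Permut X.

Definition permut_fun s : X -> X := sval s.
Coercion permut_fun : Permut >-> Funclass.

Lemma permutP s t : s =1 t -> s = t.
Proof. by case: s t => [s bs] [t bt] /funext st; exact: eq_exist. Qed.

Definition permut_one : Permut X :=
  exist _ idfun (Bijective (fun=> erefl) (fun=> erefl)).

Definition permut_mul s t : Permut X :=
  exist _ (sval s \o sval t) (bij_comp (svalP s) (svalP t)).

Lemma permut_inv_ex s : exists t : Permut X, cancel s t /\ cancel t s.
Proof.
case: s => s /= bs; have [t sK tK] := bs.
by exists (exist _ t (Bijective tK sK)).
Qed.

Definition permut_inv s : Permut X := sval (cid (permut_inv_ex s)).

Fact permut_mulA : associative permut_mul.
Proof. by move=> s t u; apply: permutP. Qed.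

Fact permut_mul1 : left_id permut_one permut_mul.
Proof. by move=> s; apply: permutP. Qed.

Fact permut_1mul : right_id permut_one permut_mul.
Proof. by move=> s; apply: permutP. Qed.

Fact permut_mulV : left_inverse permut_one permut_inv permut_mul.
Proof.
by move=> s; apply: permutP => x; have [h _] := svalP (cid (permut_inv_ex s));
  exact: h.
Qed.

Fact permut_Vmul : right_inverse permut_one permut_inv permut_mul.
Proof.
by move=> s; apply: permutP => x; have [_ h] := svalP (cid (permut_inv_ex s));
  exact: h.
Qed.

HB.instance Definition _ := isGroup.Build (Permut X)
  permut_mulA permut_mul1 permut_1mul permut_mulV permut_Vmul.

End Permut.

(* A left G-module, i.e. a Z[G]-module: an abelian group with an additive left
   action of G. *)
HB.mixin Record isGModule (G : groupType) M of GRing.Zmodule M := {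
  gact : G -> M -> M;
  gact1 : forall m, gact 1%g m = m;
  gactM : forall g h m, gact (g * h)%g m = gact g (gact h m);
  gactD : forall g m n, gact g (m + n)%R = (gact g m + gact g n)%R
}.

#[short(type="gmodType")]
HB.structure Definition GModule (G : groupType) :=
  {M of isGModule G M & GRing.Zmodule M}.

Notation "g *> m" := (gact g m) (at level 40, left associativity) : ring_scope.

Inductive mterm (G I : Type) : Type :=
| MGen of I
| MZero
| MOpp of mterm G I
| MAdd of mterm G I & mterm G I
| MAct of G & mterm G I.
Arguments MGen {G I}.
Arguments MZero {G I}.

(* The least G-module congruence containing [rel]: the G-module with generators
   I and relations [rel] is the quotient of [mterm G I] by it. *)
Inductive mcong (G : groupType) (I : Type)
    (rel : mterm G I -> mterm G I -> Prop) : mterm G I -> mterm G I -> Prop :=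
| mcong_rel s t : rel s t -> mcong rel s t
| mcong_refl s : mcong rel s s
| mcong_sym s t : mcong rel s t -> mcong rel t s
| mcong_trans s t u : mcong rel s t -> mcong rel t u -> mcong rel s u
| mcong_opp s s' : mcong rel s s' -> mcong rel (MOpp s) (MOpp s')
| mcong_add s s' t t' :
    mcong rel s s' -> mcong rel t t' -> mcong rel (MAdd s t) (MAdd s' t')
| mcong_act g s s' : mcong rel s s' -> mcong rel (MAct g s) (MAct g s')
| mcong_addA s t u : mcong rel (MAdd s (MAdd t u)) (MAdd (MAdd s t) u)
| mcong_addC s t : mcong rel (MAdd s t) (MAdd t s)
| mcong_add0 s : mcong rel (MAdd MZero s) s
| mcong_addN s : mcong rel (MAdd (MOpp s) s) MZero
| mcong_act1 s : mcong rel (MAct 1 s) s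
| mcong_actM g h s : mcong rel (MAct (g * h) s) (MAct g (MAct h s))
| mcong_actD g s t :
    mcong rel (MAct g (MAdd s t)) (MAdd (MAct g s) (MAct g t)).

HB.instance Definition _ (G I : Type) := gen_eqMixin (mterm G I).
HB.instance Definition _ (G I : Type) := gen_choiceMixin (mterm G I).

Section PresentedModule.
Variables (G : groupType) (I : Type) (rel : mterm G I -> mterm G I -> Prop).

Definition mcongb (s t : mterm G I) : bool := `[< mcong rel s t >].

Fact mcongb_refl : reflexive mcongb.
Proof. by move=> s; apply/asboolP; exact: mcong_refl. Qed.

Fact mcongb_sym : symmetric mcongb.
Proof. by move=> s t; apply/asboolP/asboolP; exact: mcong_sym. Qed.

Fact mcongb_trans : transitive mcongb.
Proof.
move=> t s u /asboolP st /asboolP tu.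
by apply/asboolP; apply: mcong_trans st tu.
Qed.

Canonical mcong_equiv := EquivRel mcongb mcongb_refl mcongb_sym mcongb_trans.

Definition presM : Type := {eq_quot mcong_equiv}.
HB.instance Definition _ := Choice.on presM.

Definition presM_class (s : mterm G I) : presM :=
  \pi_({eq_quot mcong_equiv}) s.
Definition presM_repr (a : presM) : mterm G I :=
  repr (a : {eq_quot mcong_equiv}).

Lemma presM_reprK : cancel presM_repr presM_class.
Proof. by move=> a; rewrite /presM_class /presM_repr reprK. Qed.

Lemma presM_eqP s t : presM_class s = presM_class t <-> mcong rel s t.
Proof.
rewrite /presM_class; split=> [/eqP|h].
  by rewrite eqmodE => /asboolP.
by apply/eqP; rewrite eqmodE; apply/asboolP.
Qed.

Lemma presM_ind (P : presM -> Prop) :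
  (forall s, P (presM_class s)) -> forall a, P a.
Proof. by move=> h a; rewrite -(presM_reprK a). Qed.

Lemma presM_classK s : mcong rel (presM_repr (presM_class s)) s.
Proof. by apply/presM_eqP; rewrite presM_reprK. Qed.

Definition presM_zero : presM := presM_class MZero.
Definition presM_opp (m : presM) : presM := presM_class (MOpp (presM_repr m)).
Definition presM_add (m n : presM) : presM :=
  presM_class (MAdd (presM_repr m) (presM_repr n)).
Definition presM_act (g : G) (m : presM) : presM :=
  presM_class (MAct g (presM_repr m)).

Lemma presM_oppE s : presM_opp (presM_class s) = presM_class (MOpp s).
Proof. by apply/presM_eqP; apply: mcong_opp; exact: presM_classK. Qed.

Lemma presM_addE s t :
  presM_add (presM_class s) (presM_class t) = presM_class (MAdd s t).
Proof. by apply/presM_eqP; apply: mcong_add; exact: presM_classK. Qed.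

Lemma presM_actE g s : presM_act g (presM_class s) = presM_class (MAct g s).
Proof. by apply/presM_eqP; apply: mcong_act; exact: presM_classK. Qed.

Fact presM_addA : associative presM_add.
Proof.
elim/presM_ind=> s; elim/presM_ind=> t; elim/presM_ind=> u.
by rewrite !presM_addE; apply/presM_eqP; exact: mcong_addA.
Qed.

Fact presM_addC : commutative presM_add.
Proof.
elim/presM_ind=> s; elim/presM_ind=> t.
by rewrite !presM_addE; apply/presM_eqP; exact: mcong_addC.
Qed.

Fact presM_add0 : left_id presM_zero presM_add.
Proof.
by elim/presM_ind=> s; rewrite presM_addE; apply/presM_eqP; exact: mcong_add0.
Qed.

Fact presM_addN : left_inverse presM_zero presM_opp presM_add.
Proof.
elim/presM_ind=> s; rewrite presM_oppE presM_addE.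
by apply/presM_eqP; exact: mcong_addN.
Qed.

HB.instance Definition _ := GRing.isZmodule.Build presM
  presM_addA presM_addC presM_add0 presM_addN.

Fact presM_act1 m : presM_act 1 m = m.
Proof.
elim/presM_ind: m => s; rewrite presM_actE.
by apply/presM_eqP; exact: mcong_act1.
Qed.

Fact presM_actM g h m : presM_act (g * h) m = presM_act g (presM_act h m).
Proof.
elim/presM_ind: m => s; rewrite !presM_actE.
by apply/presM_eqP; exact: mcong_actM.
Qed.

Fact presM_actD g (m n : presM) :
  presM_act g (m + n)%R = (presM_act g m + presM_act g n)%R.
Proof.
elim/presM_ind: m => s; elim/presM_ind: n => t.
rewrite [(_ + _)%R in LHS]presM_addE !presM_actE [RHS]presM_addE.
by apply/presM_eqP; exact: mcong_actD.
Qed.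

HB.instance Definition _ := isGModule.Build G presM
  presM_act1 presM_actM presM_actD.

Definition presM_gen (i : I) : presM := presM_class (MGen i).

End PresentedModule.

Section Braiding.
Variables (X : Type) (S : X * X -> X * X).

Definition gmap (x y : X) : X := (S (x, y)).1.
Definition fmap (y x : X) : X := (S (x, y)).2.

Definition S1 (t : X * X * X) : X * X * X :=
  let: (x, y, z) := t in let: (x', y') := S (x, y) in (x', y', z).
Definition S2 (t : X * X * X) : X * X * X :=
  let: (x, y, z) := t in let: (y', z') := S (y, z) in (x, y', z').

Definition braided : Prop := S1 \o S2 \o S1 =1 S2 \o S1 \o S2.

Definition nondegenerate : Prop :=
  (forall x, bijective (gmap x)) /\ (forall y, bijective (fmap y)).

End Braiding.

Record ndBraidedSet : Type := NdBraidedSet {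
  carrier :> Type;
  braiding : carrier * carrier -> carrier * carrier;
  carrier_inhabited : inhabited carrier;
  braiding_bij : bijective braiding;
  braiding_braided : braided braiding;
  braiding_nondeg : nondegenerate braiding
}.

Section Phi.
Variable X : ndBraidedSet.
Local Notation S := (@braiding X).

(* [circ x y] is x o y, [invstar y x] is y^{-1} * x, and [star y x] is y * x. *)
Definition circ (x y : X) : X := gmap S x y.
Definition invstar (y x : X) : X := fmap S y x.

Lemma invstar_surj (y x : X) : exists x', invstar y x' = x.
Proof.
have [_ /(_ y) [h _ hK]] := braiding_nondeg X.
by exists (h x); exact: hK.
Qed.

Definition star (y x : X) : X := sval (cid (invstar_surj y x)).

Definition phi (y x : X) : X := invstar x (circ (star y x) y).

Lemma starK y x : invstar y (star y x) = x.
Proof. exact: svalP (cid (invstar_surj y x)). Qed.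

Lemma invstarK y x : star y (invstar y x) = x.
Proof.
have [_ /(_ y) bf] := braiding_nondeg X.
by apply: (bij_inj bf); exact: starK.
Qed.

End Phi.

(* Graph of [phi], for a map that need not be nondegenerate: when S is the
   braiding of X, [phi_rel S x y w] means that w = phi y x. *)
Definition phi_rel (X : Type) (S : X * X -> X * X) (x y w : X) : Prop :=
  exists x' v u, S (x', y) = (v, x) /\ S (v, x) = (u, w).

Lemma phi_rel_fmap (X : Type) (S : X * X -> X * X) (z x y w : X) :
  braided S -> phi_rel S x y w ->
  phi_rel S (fmap S z x) (fmap S z y) (fmap S z w).
Proof.
move=> S_braided [x' [v [u [E1 E2]]]].
set q := fmap S z y; set r := gmap S y z.
have Eyz : S (y, z) = (r, q) by rewrite /r /q /gmap /fmap; case: (S _).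
case Exz : (S (x, z)) => [d e].
case Evd : (S (v, d)) => [a b].
case Ex'r : (S (x', r)) => [j k].
case Ekq : (S (k, q)) => [l m].
have := S_braided (x', y, z).
rewrite /= E1 /= Exz /= Evd Eyz /= Ex'r /= Ekq => -[_ bl em].
have := S_braided (v, x, z).
case Ewz : (S (w, z)) => [n o]; case Eun : (S (u, n)) => [i i'].
case Ebe : (S (b, e)) => [c c'].
rewrite /= E2 /= Ewz /= Eun Exz /= Evd /= Ebe => -[_ _ oc'].
have fx : fmap S z x = e by rewrite /fmap Exz.
have fw : fmap S z w = o by rewrite /fmap Ewz.
rewrite fx fw; exists k, b, c; split; first by rewrite Ekq bl em.
by rewrite Ebe oc'.
Qed.

Section StructureGroup.
Variable X : ndBraidedSet.
Local Notation S := (@braiding X).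

Lemma phi_relP (x y w : X) : phi_rel S x y w <-> w = phi y x.
Proof.
rewrite /phi /invstar /circ /fmap /gmap; split.
  move=> [x' [v [u [E1 E2]]]].
  have -> : star y x = x'.
    by rewrite -(invstarK y x') /invstar /fmap E1.
  by rewrite E1 /= E2.
move=> ->; have := starK y x; rewrite /invstar /fmap.
case E1 : (S _) => [v x0] /= x0x; rewrite {x0}x0x in E1.
case E2 : (S _) => [u w'] /=.
by exists (star y x), v, u.
Qed.

Lemma phi_invstar (x y z : X) :
  phi (invstar z y) (invstar z x) = invstar z (phi y x).
Proof.
symmetry; apply/phi_relP; apply: phi_rel_fmap; first exact: braiding_braided.
exact/phi_relP.
Qed.

Lemma braided_inv (T T' : X * X -> X * X) :
  cancel T T' -> cancel T' T -> braided T -> braided T'.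
Proof.
move=> TK T'K bT t.
have K1 : cancel (S1 T) (S1 T').
  move=> [[x y] z] /=; case E : (T (x, y)) => [a b] /=.
  by rewrite -E TK.
have K1' : cancel (S1 T') (S1 T).
  move=> [[x y] z] /=; case E : (T' (x, y)) => [a b] /=.
  by rewrite -E T'K.
have K2 : cancel (S2 T) (S2 T').
  move=> [[x y] z] /=; case E : (T (y, z)) => [a b] /=.
  by rewrite -E TK.
have K2' : cancel (S2 T') (S2 T).
  move=> [[x y] z] /=; case E : (T' (y, z)) => [a b] /=.
  by rewrite -E T'K.
have := bT (S1 T' (S2 T' (S1 T' t))); rewrite /= K1' K2' K1' => {2}->.
by rewrite K2 K1 K2.
Qed.

Definition half (x y : X) : X := circ (star y x) y.

Lemma braiding_half x y : S (star y x, y) = (half x y, x).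
Proof.
have := starK y x; rewrite /half /circ /invstar /gmap /fmap.
by case: (S _) => a b /= ->.
Qed.

Lemma half_bij x : bijective (half x).
Proof.
have [T SK TK] := braiding_bij X.
exists (fun u => (T (u, x)).2) => [y|u].
  by rewrite -braiding_half SK.
case E : (T (u, x)) => [a b] /=.
have Sab : S (a, b) = (u, x) by rewrite -E; exact: TK.
have -> : half x b = (S (star b x, b)).1 by rewrite braiding_half.
have -> : star b x = a by rewrite -[RHS](invstarK b) /invstar /fmap Sab.
by rewrite Sab.
Qed.

Lemma phi_half (x y z : X) : phi (half z y) (half z x) = half z (phi y x).
Proof.
have [T SK TK] := braiding_bij X.
have bT : braided T by apply: braided_inv SK TK (@braiding_braided X).
have [h hK Kh] := half_bij z.
have hE u : h u = fmap T z u.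
  rewrite /fmap -{2}(Kh u).
  by have /(congr1 T) := braiding_half z (h u); rewrite SK => <-.
have relT a b c : phi_rel S a b c <-> phi_rel T a c b.
  split.
    move=> [a' [v [u [E1 E2]]]]; exists u, v, a'.
    by split; rewrite -?E1 -?E2 SK.
  move=> [a' [v [u [E1 E2]]]]; exists u, v, a'.
  by split; rewrite -?E1 -?E2 TK.
have /phi_relP/relT/(phi_rel_fmap z bT) := erefl (phi (half z y) (half z x)).
rewrite -!hE !hK => /relT/phi_relP <-.
by rewrite Kh.
Qed.

Lemma phi_distr (x y z : X) :
  phi (phi z y) x = phi (phi z x) (phi y x).
Proof.
have phiE w : phi w x = invstar x (half x w) by [].
by rewrite !phiE phi_invstar phi_half.
Qed.

Lemma phi_bij (x : X) : bijective (fun y => phi y x).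
Proof.
have [_ bf] := braiding_nondeg X.
exact: bij_comp (bf x) (half_bij x).
Qed.

Inductive AX_rel : gterm X -> gterm X -> Prop :=
| AXRel x y y1 x1 x2 y2 of S (x, y) = (y1, x1) & S (y1, x1) = (x2, y2) :
    AX_rel (GMul (GGen x1) (GGen y)) (GMul (GGen y2) (GGen x1)).

Definition AX : Type := presG AX_rel.
HB.instance Definition _ := Group.on AX.

Definition psiA (x : X) : AX := presG_gen AX_rel x.

Lemma psiA_phi x y : psiA (phi y x) * psiA x = psiA x * psiA y.
Proof.
rewrite -[LHS]/(presG_mul _ _) -[RHS]/(presG_mul _ _) !presG_mulE.
have /phi_relP [x' [v [u [E1 E2]]]] := erefl (phi y x).
by apply/presG_eqP/gcong_sym/gcong_rel; apply: AXRel E1 E2.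
Qed.

Definition phi_permut (x : X) : Permut X := exist _ (fun y => phi y x) (phi_bij x).

Lemma phi_permut_rel s t :
  AX_rel s t -> geval phi_permut s = geval phi_permut t.
Proof.
case=> x y y1 x1 x2 y2 E1 E2 /=; apply: permutP => z.
have -> : y2 = phi y x1 by apply/phi_relP; exists x, y1, x2.
exact: phi_distr.
Qed.

Definition AX_act : AX -> Permut X :=
  @presG_lift X (Permut X) phi_permut AX_rel.

Lemma AX_actM : {morph AX_act : a b / a * b}.
Proof. exact/presG_liftM/phi_permut_rel. Qed.

HB.instance Definition _ := isGroupMorphism.Build AX (Permut X) AX_act
  (morphM_morphF AX_actM).

Lemma AX_act_psiA x y : AX_act (psiA x) y = phi y x.
Proof. by rewrite /AX_act (presG_lift_gen phi_permut_rel). Qed.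

Definition AX0_pred : {pred Permut X} :=
  fun s => `[< range AX_act s >].

Fact AX0_closed : group_closed AX0_pred.
Proof.
split; first by apply/asboolP; exists 1; rewrite ?gmulf1.
move=> s t /asboolP[a _ <-] /asboolP[b _ <-].
by apply/asboolP; exists (a / b); rewrite ?gmulfF.
Qed.

Definition AX0 : Type := {s : Permut X | s \in AX0_pred}.
HB.instance Definition _ := SubChoice.on AX0.
HB.instance Definition _ :=
  SubChoice_isSubGroup.Build (Permut X) (mem AX0_pred) AX0 AX0_closed.

Lemma AX_act_in (a : AX) : AX_act a \in AX0_pred.
Proof. by apply/asboolP; exists a. Qed.

Definition pA (a : AX) : AX0 := exist _ (AX_act a) (AX_act_in a).

Fact pA_morph : {morph pA : a b / a * b}.
Proof. by move=> a b; apply: val_inj; rewrite gmulfM /= AX_actM. Qed.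

HB.instance Definition _ := isGroupMorphism.Build AX AX0 pA
  (morphM_morphF pA_morph).

Inductive MX_rel : mterm AX0 X -> mterm AX0 X -> Prop :=
| MXRel (x y : X) :
    MX_rel (MAdd (MAct (pA (psiA y))^-1 (MGen x)) (MGen y))
           (MAdd (MAct (pA (psiA x))^-1 (MGen (phi y x))) (MGen x)).

Definition MX : Type := presM MX_rel.
HB.instance Definition _ := GModule.on MX.

Definition psiM (x : X) : MX := presM_gen MX_rel x.

End StructureGroup.

(* A acts on the G-module M through p : A -> G. *)
Definition cocycle1 (A G : groupType) (p : A -> G) (M : gmodType G)
    (theta : A -> M) : Prop :=
  forall a b : A, theta (a * b) = (p b^-1%g *> theta a + theta b)%R.

(* Main.v *)
Require Import Defs.
From HB Require Import structures.
From mathcomp Require Import all_boot all_order all_algebra.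
From mathcomp Require Import boolp classical_sets functions.

(** Existence.  A 1-cocycle A -> M is the same thing as a group morphism from A
to a semidirect product of G and M lying over p : A -> G.  The defining
relations of M_X say exactly that x |-> (p x, v_x) respects the relations
phi(y, x) x = x y of A_X, so this assignment extends to A_X and its second
component is the required theta (theta_univ).  A cocycle is determined by its
values on generators (cocycle1_ext), whence uniqueness.

Injectivity.  Every 1-cocycle c from A_X to an A_X^0-module factors through
M_X: if v_x = v_y then c (psi x) = c (psi y) (cocycle_psiM).  So it suffices to
exhibit enough cocycles to separate the elements of A_X, and two are enough.

The first one is the coboundary of the delta function at 1 in the module of
integer functions on A_X^0; it determines p a (delta_cocycle_inj).

For the second, note that in A_X one has a psi(x) a^-1 = psi(a . x), so the
kernel K of p, which acts trivially on X, is central (pA_ker_central), hence an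
abelian group.  Choose a set-theoretic section s of p.  Then

  c_a(h) = s(p(a) h)^-1 a s(h)

lies in K, and a |-> c_a is a cocycle with values in the module of functions
A_X^0 -> K; this is the embedding of the extension A_X into the wreath product
of K by A_X^0.  If p a = p b and c_a(1) = c_b(1), then a = b. *)

Set Implicit Arguments.
Unset Strict Implicit.
Unset Printing Implicit Defensive.

Import GRing.Theory.

Local Open Scope group_scope.

(** * Cocycles on presented groups *)

Lemma gact0 (G : groupType) (M : gmodType G) (g : G) :
  (g *> (0 : M) = 0)%R.
Proof. by apply: (addrI (g *> 0)%R); rewrite -gactD !addr0. Qed.

Lemma gactN (G : groupType) (M : gmodType G) (g : G) (m : M) :
  (g *> (- m) = - (g *> m))%R.
Proof. by apply: (addrI (g *> m)%R); rewrite -gactD !subrr gact0. Qed.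

Lemma presG_gen_ind (X : Type) (rel : gterm X -> gterm X -> Prop)
    (P : presG rel -> Prop) :
  (forall x, P (presG_gen rel x)) -> P 1 -> (forall a, P a -> P a^-1) ->
  (forall a b, P a -> P b -> P (a * b)) -> forall a, P a.
Proof.
move=> Pgen P1 PV PM; elim/presG_ind; elim=> [x||s Ps|s Ps t Pt].
- exact: Pgen.
- exact: P1.
- by rewrite -presG_invE; apply: PV.
- by rewrite -presG_mulE; apply: PM.
Qed.

Section Cocycle.
Variables (A G : groupType) (p : A -> G) (M : gmodType G).
Hypothesis pM : {morph p : a b / a * b}.

Let p1 : p 1 = 1.
Proof. by apply: (mulgI (p 1)); rewrite -pM !mulg1. Qed.

Lemma cocycle1_1 (theta : A -> M) : cocycle1 p theta -> theta 1 = 0%R.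
Proof.
move=> thetaM; apply: (@addrI _ (theta 1)).
by have := thetaM 1 1; rewrite mulg1 invg1 p1 gact1 addr0 => <-.
Qed.

Lemma cocycle1V (theta : A -> M) a :
  cocycle1 p theta -> theta a^-1 = (- (p a *> theta a))%R.
Proof.
move=> thetaM; apply: (@addrI _ (p a *> theta a)%R).
have := thetaM a a^-1; rewrite invgK mulgV (cocycle1_1 thetaM) => <-.
by rewrite subrr.
Qed.

End Cocycle.

Lemma cocycle1_ext (X : Type) (rel : gterm X -> gterm X -> Prop)
    (G : groupType) (p : presG rel -> G) (M : gmodType G)
    (theta theta' : presG rel -> M) :
  {morph p : a b / a * b} -> cocycle1 p theta -> cocycle1 p theta' ->
  (forall x, theta (presG_gen rel x) = theta' (presG_gen rel x)) ->
  theta = theta'.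
Proof.
move=> pM thetaM thetaM' eq_gen; apply: funext.
elim/presG_gen_ind=> [x||a IHa|a b IHa IHb].
- exact: eq_gen.
- by rewrite !(cocycle1_1 pM).
- by rewrite !(cocycle1V pM) // IHa.
- by rewrite thetaM thetaM' IHa IHb.
Qed.

(** * Semidirect products and coinduced modules *)

Section SemidirectProduct.
Variables (G : groupType) (M : gmodType G).

(** The multiplication twists the module component of the left factor by the
inverse of the right one, so that a |-> (p a, theta a) is multiplicative
exactly when theta satisfies theta (a b) = b^-1 theta a + theta b. *)
Definition semidirect : Type := (G * M)%type.
HB.instance Definition _ := Choice.on semidirect.

Implicit Types u v w : semidirect.

Definition sd_one : semidirect := (1, 0%R).
Definition sd_mul u v : semidirect := (u.1 * v.1, (v.1^-1 *> u.2 + v.2)%R).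
Definition sd_inv u : semidirect := (u.1^-1, (- (u.1 *> u.2))%R).

Fact sd_mulA : associative sd_mul.
Proof.
move=> u v w; congr pair => /=; first exact: mulgA.
by rewrite gactD -gactM invgM addrA.
Qed.

Fact sd_mul1 : left_id sd_one sd_mul.
Proof.
by case=> g m; rewrite /sd_mul /= mul1g gact0 add0r.
Qed.

Fact sd_1mul : right_id sd_one sd_mul.
Proof.
by case=> g m; rewrite /sd_mul /= mulg1 invg1 gact1 addr0.
Qed.

Fact sd_Vmul : right_inverse sd_one sd_inv sd_mul.
Proof.
by case=> g m; rewrite /sd_mul /= mulgV invgK subrr.
Qed.

Fact sd_mulV : left_inverse sd_one sd_inv sd_mul.
Proof.
by case=> g m; rewrite /sd_mul /= mulVg gactN -gactM mulVg gact1 addNr.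
Qed.

HB.instance Definition _ := isGroup.Build semidirect
  sd_mulA sd_mul1 sd_1mul sd_mulV sd_Vmul.

End SemidirectProduct.

Section CoinducedModule.
Variables (G : groupType) (V : zmodType).

(** A new name for the function type, so that the action by translation is not
attached to arbitrary functions. *)
Definition coind : Type := G -> V.
HB.instance Definition _ := GRing.Zmodule.on coind.

Definition coind_act (g : G) (f : coind) : coind := fun h => f (g^-1 * h).

Fact coind_act1 f : coind_act 1 f = f.
Proof. by apply: funext => h; rewrite /coind_act invg1 mul1g. Qed.

Fact coind_actM g h f : coind_act (g * h) f = coind_act g (coind_act h f).
Proof. by apply: funext => k; rewrite /coind_act invgM mulgA. Qed.

Fact coind_actD g (f f' : coind) :
  coind_act g (f + f')%R = (coind_act g f + coind_act g f')%R.
Proof. by []. Qed.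

HB.instance Definition _ := isGModule.Build G coind
  coind_act1 coind_actM coind_actD.

End CoinducedModule.

(** * The universal cocycle and its factorisation property *)

Section UniversalCocycle.
Variable X : ndBraidedSet.
Local Notation A := (AX X).
Local Notation p := (@pA X).
Local Notation psi := (@psiA X).

Lemma psiM_rel (x y : X) :
  (p (psi y)^-1%g *> psiM x + psiM y =
   p (psi x)^-1%g *> psiM (phi y x) + psiM x)%R.
Proof.
rewrite !gmulfV.
rewrite -[LHS]/(presM_add (presM_act _ _) _).
rewrite -[RHS]/(presM_add (presM_act _ _) _).
by rewrite !presM_actE !presM_addE; apply/presM_eqP/mcong_rel.
Qed.

Definition semidirect_gen (x : X) : semidirect (MX X) := (p (psi x), psiM x).

Lemma semidirect_gen_rel s t :
  AX_rel s t -> geval semidirect_gen s = geval semidirect_gen t.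
Proof.
case=> x y y1 x1 x2 y2 E1 E2.
have -> : y2 = phi y x1 by apply/phi_relP; exists x, y1, x2.
rewrite /semidirect_gen /= -[LHS]/(sd_mul _ _) -[RHS]/(sd_mul _ _).
by congr pair => /=; rewrite -?gmulfM ?psiA_phi // -!gmulfV psiM_rel.
Qed.

Definition semidirect_lift : A -> semidirect (MX X) :=
  presG_lift semidirect_gen (rel := @AX_rel X).

Lemma semidirect_liftM : {morph semidirect_lift : a b / a * b}.
Proof. exact/presG_liftM/semidirect_gen_rel. Qed.

HB.instance Definition _ := isGroupMorphism.Build A (semidirect (MX X))
  semidirect_lift (morphM_morphF semidirect_liftM).

Lemma semidirect_lift_psiA x : semidirect_lift (psi x) = semidirect_gen x.
Proof. exact: presG_lift_gen semidirect_gen_rel x. Qed.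

Lemma semidirect_lift1 a : (semidirect_lift a).1 = p a.
Proof.
elim/presG_gen_ind: a => [x||a IHa|a b IHa IHb].
- by rewrite semidirect_lift_psiA.
- by rewrite !gmulf1.
- by rewrite !gmulfV /= IHa.
- by rewrite !gmulfM /= IHa IHb.
Qed.

Definition theta_univ (a : A) : MX X := (semidirect_lift a).2.

Lemma theta_univ_cocycle : cocycle1 p theta_univ.
Proof.
by move=> a b; rewrite /theta_univ gmulfM /= semidirect_lift1 gmulfV.
Qed.

Lemma theta_univ_psiA x : theta_univ (psi x) = psiM x.
Proof. by rewrite /theta_univ semidirect_lift_psiA. Qed.

Section CocycleFactor.
Variables (N : gmodType (AX0 X)) (c : A -> N).
Hypothesis cM : cocycle1 p c.

Fixpoint meval (s : mterm (AX0 X) X) : N :=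
  match s with
  | MGen x => c (psi x)
  | MZero => 0%R
  | MOpp s => (- meval s)%R
  | MAdd s t => (meval s + meval t)%R
  | MAct g s => (g *> meval s)%R
  end.

Lemma meval_cong s t : mcong (@MX_rel X) s t -> meval s = meval t.
Proof.
elim=> {s t} //=.
- by move=> _ _ [x y] /=; rewrite -!gmulfV -!cM psiA_phi.
- by move=> s t u _ -> _ ->.
- by move=> s s' _ ->.
- by move=> s s' t t' _ -> _ ->.
- by move=> g s s' _ ->.
- by move=> s t u; rewrite addrA.
- by move=> s t; rewrite addrC.
- by move=> s; rewrite add0r.
- by move=> s; rewrite addNr.
- by move=> s; rewrite gact1.
- by move=> g h s; rewrite gactM.
- by move=> g s t; rewrite gactD.
Qed.

(** Half of the universal property of M_X: evaluating formal module
expressions through c kills the relations, so c on generators depends only on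
the classes v_x. *)
Lemma cocycle_psiM x y : psiM x = psiM y -> c (psi x) = c (psi y).
Proof. by move/presM_eqP/meval_cong. Qed.

End CocycleFactor.

End UniversalCocycle.

(** * Cocycles separating the points of the structure group *)

Section Injectivity.
Variable X : ndBraidedSet.
Local Notation A := (AX X).
Local Notation p := (@pA X).
Local Notation psi := (@psiA X).

(** The defining relation says this when a is a generator; both sides being
compatible with products and inverses of a, it propagates to the whole group. *)
Lemma psiA_act (a : A) x : psi (AX_act a x) * a = a * psi x.
Proof.
elim/presG_gen_ind: a x => [y||a IHa|a b IHa IHb] x.
- by rewrite AX_act_psiA psiA_phi.
- by rewrite gmulf1 mulg1 mul1g.
- apply: (mulgI a); rewrite mulgA -IHa mulgK mulVKg.
  by rewrite -[AX_act a _]/(permut_fun (AX_act a * AX_act a^-1) x) gmulfV mulgV.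
- by rewrite gmulfM mulgA IHa -mulgA IHb mulgA.
Qed.

(** An element acting trivially on X commutes with every generator, by
psiA_act. *)
Lemma pA_ker_central (k a : A) : p k = 1 -> commute k a.
Proof.
move=> /(congr1 val) k1; elim/presG_gen_ind: a => [x||a|a b].
- by rewrite /commute -psiA_act [AX_act k]k1.
- exact: commute1.
- exact: commuteV.
- exact: commuteM.
Qed.

(** A type for the kernel of p, so that it can carry an additive group structure
and serve as coefficients of a coinduced module. *)
Definition kerp : Type := {a : A | `[< p a = 1 >]}.
HB.instance Definition _ := SubChoice.on kerp.

Definition kerp_of (a : A) (a1 : p a = 1) : kerp :=
  exist _ a (introT (asboolP _) a1).

Implicit Types k l : kerp.

Lemma kerpP k : p (val k) = 1.
Proof. exact/asboolP/(valP k). Qed.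

Fact pA_kerV (a : A) : p a = 1 -> p a^-1 = 1.
Proof. by move=> a1; rewrite gmulfV /= a1 invg1. Qed.

Fact pA_kerM (a b : A) : p a = 1 -> p b = 1 -> p (a * b) = 1.
Proof. by move=> a1 b1; rewrite gmulfM /= a1 b1 mulg1. Qed.

Definition kerp_one := kerp_of (gmulf1 : p 1 = 1).
Definition kerp_inv k := kerp_of (pA_kerV (kerpP k)).
Definition kerp_mul k l := kerp_of (pA_kerM (kerpP k) (kerpP l)).

Fact kerp_mulA : associative kerp_mul.
Proof. by move=> k l m; apply: val_inj; apply: mulgA. Qed.
Fact kerp_mulC : commutative kerp_mul.
Proof. by move=> k l; apply: val_inj; apply/pA_ker_central/kerpP. Qed.
Fact kerp_mul1 : left_id kerp_one kerp_mul.
Proof. by move=> k; apply: val_inj; apply: mul1g. Qed.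
Fact kerp_mulV : left_inverse kerp_one kerp_inv kerp_mul.
Proof. by move=> k; apply: val_inj; apply: mulVg. Qed.

HB.instance Definition _ := GRing.isZmodule.Build kerp
  kerp_mulA kerp_mulC kerp_mul1 kerp_mulV.

Lemma pA_surj (g : AX0 X) : exists a, p a = g.
Proof.
case: (asboolP _ (valP g)) => a _ ag.
by exists a; apply: val_inj.
Qed.

Definition sect (g : AX0 X) : A := sval (cid (pA_surj g)).

Lemma sectK g : p (sect g) = g.
Proof. exact: svalP (cid (pA_surj g)). Qed.

Fact kerp_cocycle_subproof a h : p ((sect (p a * h))^-1 * a * sect h) = 1.
Proof. by rewrite !gmulfM gmulfV /= !sectK -mulgA mulVg. Qed.

(** The cocycle of the embedding of A_X into the wreath product of the kernel by
A_X^0, relative to the section sect. *)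
Definition kerp_cocycle (a : A) : coind (AX0 X) kerp :=
  fun h => kerp_of (kerp_cocycle_subproof a h).

Lemma kerp_cocycle_cocycle : cocycle1 p kerp_cocycle.
Proof.
move=> a b; apply: funext => h; apply: val_inj.
(* In the functions on A_X^0, b^-1 acts by h |-> p b * h; the middle factor
   sect (p b * h) then cancels. *)
rewrite -[RHS]/(val (kerp_cocycle a ((p b^-1)^-1 * h)) *
                val (kerp_cocycle b h)).
by rewrite -gmulfV invgK /= gmulfM !mulgA mulgK.
Qed.

Definition delta1 : coind (AX0 X) int := fun h => ((h == 1%g)%:R)%R.

Definition delta_cocycle (a : A) : coind (AX0 X) int :=
  (p a^-1%g *> delta1 - delta1)%R.

Lemma delta_cocycle_cocycle : cocycle1 p delta_cocycle.
Proof.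
move=> a b; rewrite /delta_cocycle invgM gmulfM gactM gactD gactN.
by rewrite addrA subrK.
Qed.

Lemma delta_cocycle_inj a b : delta_cocycle a = delta_cocycle b -> p a = p b.
Proof.
move=> /addIr/(congr1 (@^~ (p b)^-1)).
(* Evaluated at (p b)^-1, the translate of delta1 by b^-1 takes the value 1. *)
rewrite /= -[LHS]/(delta1 _) -[RHS]/(delta1 _) /delta1 !gmulfV.
by rewrite !invgK mulgV eqxx; case: eqP => // /divg1_eq.
Qed.

Lemma kerp_cocycle_inj a b :
  p a = p b -> kerp_cocycle a = kerp_cocycle b -> a = b.
Proof.
move=> pab /(congr1 (fun f => val (f 1))) /= /mulIg.
by rewrite pab => /mulgI.
Qed.

(** The two cocycles are used in turn: the first gives equal images under p,
which the comparison of the second requires. *)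
Lemma psiM_psiA x y : psiM x = psiM y -> psi x = psi y.
Proof.
move=> xy; apply: kerp_cocycle_inj.
- exact/delta_cocycle_inj/(cocycle_psiM delta_cocycle_cocycle).
- exact: (cocycle_psiM kerp_cocycle_cocycle).
Qed.

End Injectivity.

Theorem theorem2p9 (X : ndBraidedSet) :
  (exists! theta : AX X -> MX X,
     cocycle1 (@pA X) theta /\ theta \o @psiA X = @psiM X) /\
  (forall theta : AX X -> MX X,
     cocycle1 (@pA X) theta -> theta \o @psiA X = @psiM X ->
     set_inj (range (@psiA X)) theta).
Proof.
split=> [|theta _ theta_psi].
  exists (@theta_univ X); split=> [|theta [thetaM theta_psi]].
    split; first exact: theta_univ_cocycle.
    by apply: funext => x; exact: theta_univ_psiA.
  apply: cocycle1_ext (@theta_univ_cocycle X) thetaM _ => [|x].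
    exact: pA_morph.
  by rewrite theta_univ_psiA -theta_psi.
move=> _ _ /set_mem[x _ <-] /set_mem[y _ <-].
rewrite -[LHS]/((theta \o @psiA X) x) -[RHS]/((theta \o @psiA X) y) theta_psi.
exact: psiM_psiA.
Qed.
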